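(* Let $D=(X,\mathcal{B})$ be a non-symmetric $2$-$(v,k,1)$ design. Then $$2k-1\leq \gamma(D)\leq \frac{(v-k^2)(v-1)}{k(k-1)}+2k-1.$$
   Context: Let $v,k,\lambda$ be positive integers with $v\geq k\geq 2$. A $2$-$(v,k,\lambda)$ design $D=(X,\mathcal{B})$ consists of a set $X$ of $v$ points and a family $\mathcal{B}$ of $k$-subsets of $X$ (blocks) such that every pair of distinct points is contained in exactly $\lambda$ blocks; $b=|\mathcal{B}|$, and $D$ is symmetric if $b=v$ (non-symmetric otherwise). The incidence graph $G_D$ is the bipartite graph with vertex set $X\cup\mathcal{B}$ in which a point $x$ is adjacent to a block $B$ iff $x\in B$. A dominating set of a graph is a set $S$ of vertices such that every vertex not in $S$ is adjacent to some vertex of $S$; $\gamma(D)$ denotes the minimum size of a dominating set of $G_D$.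
   Formalization: The lower bound is stated only for k < v: when v = k the design has the single block X, is non-symmetric (b = 1), and has γ(D) = 1 < 2k−1, so the lower bound fails there; the upper bound is stated for all v ≥ k. *)

(* Defs.v *)
From HB Require Import structures.
From mathcomp Require Import all_boot all_order all_algebra.
Set Implicit Arguments.
Unset Strict Implicit.
Unset Printing Implicit Defensive.

(* Blocks form an indexed family, so repeated blocks are allowed and
   b = #|block D| counts them with multiplicity. *)
Record design (v k l : nat) := Design {
  point : finType;
  block : finType;
  block_set : block -> {set point};
  lambda_gt0 : 0 < l;
  design_k_ge2 : 2 <= k;
  design_k_le_v : k <= v;
  card_point : #|point| = v;
  card_block_set : forall B : block, #|block_set B| = k;
  design_balanced : forall x y : point, x != y ->
    #|[set B : block | (x \in block_set B) && (y \in block_set B)]| = l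
}.

Definition symmetric_design v k l (D : design v k l) : Prop :=
  #|block D| = v.

Definition incidence_graph v k l (D : design v k l) :
    rel (point D + block D) :=
  fun u w => match u, w with
    | inl x, inr B => x \in block_set B
    | inr B, inl x => x \in block_set B
    | _, _ => false
    end.

Arguments incidence_graph {v k l} D _ _.

Definition dominating (T : finType) (e : rel T) (S : {set T}) : bool :=
  [forall u, (u \notin S) ==> [exists w in S, e u w]].

Definition domination_number (T : finType) (e : rel T) : nat :=
  #|[arg min_(S < [set: T] | dominating e S) #|S|]|.

Definition gamma v k l (D : design v k l) : nat :=
  domination_number (incidence_graph D).

Lemma incidence_graph_sym v k l (D : design v k l) :
  symmetric (incidence_graph D).
Proof. by case=> [x|B] [y|C]. Qed.

Lemma incidence_graph_irr v k l (D : design v k l) :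
  irreflexive (incidence_graph D).
Proof. by case. Qed.

Lemma dominatingT (T : finType) (e : rel T) : dominating e [set: T].
Proof. by apply/forallP=> u; rewrite in_setT. Qed.

Lemma domination_numberP (T : finType) (e : rel T) :
  (exists2 S, dominating e S & #|S| = domination_number e) /\
  (forall S, dominating e S -> domination_number e <= #|S|).
Proof.
rewrite /domination_number; case: arg_minnP => [|S dS minS].
  exact: dominatingT.
by split=> //; exists S.
Qed.

(* Main.v *)
Require Import Defs.
From mathcomp Require Import all_boot all_order all_algebra.
From mathcomp Require Import zify ring lra.
Set Implicit Arguments.
Unset Strict Implicit.
Unset Printing Implicit Defensive.
Import Order.TTheory GRing.Theory Num.Theory.

(** Every point lies on r = (v - 1)/(k - 1) blocks, and b k = v r.  If B is a
block and x a point off B, the k points of B are joined to x by k distinct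
blocks, so k <= r, and k < r when D is not symmetric.

Upper bound: the points of B together with the b - k r + k - 1 blocks disjoint
from B dominate, since k < r leaves a block through x that misses B.

Lower bound: if s points and t blocks dominate, then v <= s + t k and
b <= t + s r.  With v >= k^2, s + t <= 2k - 2 forces t >= k by the first
inequality, hence s <= k - 2, which contradicts the second. *)

Lemma card_set_sum (A B : finType) (S : {set A + B}) :
  #|S| = #|[set x | inl x \in S]| + #|[set y | inr y \in S]|.
Proof.
rewrite -!sum1_card big_mkcond big_sumType /=; congr (_ + _);
  by rewrite [RHS]big_mkcond; apply: eq_bigr => i _; rewrite inE.
Qed.

Section LinearDesign.

Variables (v k : nat) (D : design v k 1).
Implicit Types (x y z : point D) (B C : block D).

Lemma double_count (A : {set point D}) (P : {set block D}) :
  \sum_(x in A) #|[set C in P | x \in block_set C]|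
    = \sum_(C in P) #|A :&: block_set C|.
Proof.
transitivity (\sum_(x in A) \sum_(C in P) (x \in block_set C : nat)).
  apply: eq_bigr => x _; rewrite -sum1_card big_mkcond [RHS]big_mkcond.
  by apply: eq_bigr => C _; rewrite inE; do 2!case: (_ \in _).
rewrite exchange_big; apply: eq_bigr => C _.
rewrite -sum1_card big_mkcond [RHS]big_mkcond.
by apply: eq_bigr => x _; rewrite inE; do 2!case: (_ \in _).
Qed.

(** A closed form that refers to no point; the division is exact by [replicationE]. *)
Definition replication := (v - 1) %/ (k - 1).

(** Count pairs of a point y other than x and a block containing both: each y gives one block, each
    block through x gives k - 1 points. *)
Lemma card_blocks_through_mul x :
  #|[set C | x \in block_set C]| * (k - 1) = v - 1.
Proof.
have := double_count [set~ x] [set C | x \in block_set C].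
rewrite (eq_bigr (fun=> 1)) => [|y]; last first.
  rewrite !inE eq_sym => neq_xy; rewrite -[RHS](design_balanced neq_xy).
  by apply: eq_card => C; rewrite !inE.
rewrite sum1_card cardsC1 card_point [RHS](eq_bigr (fun=> k - 1)) => [|C].
  by rewrite sum_nat_const => <-; rewrite subn1.
rewrite inE => xC; rewrite setIC -setDE.
by have := cardsD1 x (block_set C); rewrite xC card_block_set; lia.
Qed.

Lemma card_blocks_through x : #|[set C | x \in block_set C]| = replication.
Proof.
have := design_k_ge2 D => k2.
by rewrite /replication -(card_blocks_through_mul x) mulnK //; lia.
Qed.

Lemma replicationE : replication * (k - 1) = v - 1.
Proof.
have := design_k_ge2 D; have := design_k_le_v D => kv k2.
have /card_gt0P[x _] : 0 < #|point D| by rewrite card_point; lia.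
by rewrite -(card_blocks_through x) card_blocks_through_mul.
Qed.

Lemma sum_card_block_meet (A : {set point D}) :
  \sum_C #|A :&: block_set C| = #|A| * replication.
Proof.
have := double_count A setT; rewrite [RHS](eq_bigl xpredT) => [<-|C]; last first.
  by rewrite inE.
rewrite -sum_nat_const; apply: eq_bigr => x _.
by rewrite -(card_blocks_through x); apply: eq_card => C; rewrite !inE.
Qed.

Lemma card_blockE : #|block D| * k = v * replication.
Proof.
rewrite -[X in _ = X * _](card_point D) -[X in _ = X * _]cardsT.
rewrite -sum_card_block_meet -sum_nat_const.
by apply: eq_bigr => C _; rewrite setTI card_block_set.
Qed.

Lemma card_block_gt0 : 0 < #|block D|.
Proof.
have := design_k_ge2 D; have := design_k_le_v D => kv k2.
have /card_gt1P[x [y [_ _ neq_xy]]] : 1 < #|point D|.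
  by rewrite card_point; lia.
have /card_gt0P[B _] := eq_leq (esym (design_balanced neq_xy)).
by apply/card_gt0P; exists B.
Qed.

Lemma card_blockI B C : B != C -> #|block_set B :&: block_set C| <= 1.
Proof.
move=> neq_BC; rewrite leqNgt; apply/negP => /card_gt1P[x [y []]].
rewrite !inE => /andP[xB xC] /andP[yB yC] neq_xy.
have /eqP/cards1P[E defE] := design_balanced neq_xy.
have := in_set1 B E; have := in_set1 C E.
rewrite -defE !inE xB xC yB yC => /esym/eqP eCE /esym/eqP eBE.
by rewrite eBE eCE eqxx in neq_BC.
Qed.

(** Each of the k points of B is joined to x by exactly one block. *)
Lemma sum_card_meet_through x B : x \notin block_set B ->
  \sum_(C in [set C | x \in block_set C]) #|block_set B :&: block_set C| = k.
Proof.
move=> xB; rewrite -double_count -[RHS](card_block_set B) -sum1_card.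
apply: eq_bigr => y yB.
have neq_xy : x != y by apply: contraNneq xB => ->.
by rewrite -[RHS](design_balanced neq_xy); apply: eq_card => C; rewrite !inE.
Qed.

Lemma replication_ge x B : x \notin block_set B -> k <= replication.
Proof.
move=> xB; rewrite -(sum_card_meet_through xB) -(card_blocks_through x).
rewrite -sum1_card; apply: leq_sum => C; rewrite inE => xC.
by apply: card_blockI; apply: contraNneq xB => ->.
Qed.

Hypothesis nsymD : ~ symmetric_design D.

Lemma replication_gt x B : x \notin block_set B -> k < replication.
Proof.
move=> xB; rewrite ltn_neqAle (replication_ge xB) andbT.
(* If r = k, then b k = v r forces b = v. *)
apply/eqP => kr; apply: nsymD; apply/eqP.
have := design_k_ge2 D => k2.
by have := card_blockE; rewrite -kr => /eqP; rewrite eqn_pmul2r //; lia.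
Qed.

Definition disjoint_blocks B :=
  [set C | block_set B :&: block_set C == set0].

(** If all r blocks through x met B, their intersections with B would sum to at least r > k. *)
Lemma exists_disjoint_block x B : x \notin block_set B ->
  exists2 C, C \in disjoint_blocks B & x \in block_set C.
Proof.
move=> xB; apply/exists_inP; apply/contraT => /exists_inPn noC.
have := replication_gt xB; rewrite ltnNge => /negP[].
rewrite -(sum_card_meet_through xB) -(card_blocks_through x) -sum1_card.
apply: leq_sum => C; rewrite inE card_gt0 => xC.
by apply: contraL xC => disjC; apply: noC; rewrite inE.
Qed.

(** Sum over all blocks C the size of the intersection with B, plus 1 if it is empty: B itself gives
    k, every other block exactly 1. *)
Lemma card_disjoint_blocks B :
  #|disjoint_blocks B| + k * replication + 1 = #|block D| + k.
Proof.
have k2 := design_k_ge2 D.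
rewrite -[X in X * _](card_block_set B) -sum_card_block_meet -sum1_card big_mkcond.
rewrite -big_split (bigD1 B) //= inE setIid -cards_eq0 card_block_set.
rewrite (eq_bigr (fun=> 1)) => [|C neq_CB]; last first.
  rewrite inE -cards_eq0; move: (@card_blockI B C); rewrite eq_sym => /(_ neq_CB).
  by case: #|_| => [|[]].
rewrite sum1_card cardC1 (gtn_eqF (ltnW k2)) -[in RHS](prednK card_block_gt0).
by lia.
Qed.

Lemma gamma_le B : gamma D <= k + #|disjoint_blocks B|.
Proof.
have [_ minS] := domination_numberP (incidence_graph D).
pose S := [set u : point D + block D | match u with
  | inl x => x \in block_set B | inr C => C \in disjoint_blocks B end].
apply: leq_trans (minS S _) _; last first.
  rewrite card_set_sum -[X in _ <= X + _](card_block_set B) eq_leq //.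
  by congr (_ + _); apply: eq_card => u; rewrite !inE.
apply/forallP => -[x|C]; apply/implyP; rewrite inE => uS; apply/exists_inP.
  have [C disjC xC] := exists_disjoint_block uS.
  by exists (inr C); rewrite ?inE in disjC *.
move: uS; rewrite inE => /set0Pn[x]; rewrite inE => /andP[xB xC].
by exists (inl x); rewrite ?inE.
Qed.

Section DominatingSet.

Variable S : {set point D + block D}.
Hypothesis domS : dominating (incidence_graph D) S.
Let P := [set x | inl x \in S].
Let T := [set C | inr C \in S].

(** Every point outside P lies on a block of T, and such a block covers at most k of them. *)
Lemma dominating_points_le : v <= #|P| + #|T| * k.
Proof.
rewrite -[leqLHS](card_point D) -(cardsC P) leq_add2l -sum1_card.
apply: (@leq_trans (\sum_(C in T) #|~: P :&: block_set C|)); last first.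
  rewrite -sum_nat_const; apply: leq_sum => C _.
  by rewrite -[leqRHS](card_block_set C) subset_leq_card ?subsetIr.
rewrite -double_count; apply: leq_sum => x; rewrite !inE => xS.
have /implyP/(_ xS)/exists_inP[[y|C] //= CS xC] := forallP domS (inl x).
by apply/card_gt0P; exists C; rewrite !inE CS.
Qed.

Lemma dominating_blocks_le : #|block D| <= #|T| + #|P| * replication.
Proof.
rewrite -(cardsC T) leq_add2l -sum_card_block_meet -sum1_card big_mkcond.
apply: leq_sum => C _; rewrite !inE; case: ifP => // CS.
have /implyP/(_ CS)/exists_inP[[x|B] //= xS xC] := forallP domS (inr C).
by apply/card_gt0P; exists x; rewrite !inE xS.
Qed.

Lemma dominating_ge : k < v -> 2 * k - 1 <= #|S|.
Proof.
move=> lt_kv; rewrite card_set_sum -/P -/T.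
have k2 := design_k_ge2 D; have /card_gt0P[B _] := card_block_gt0.
have /set0Pn[x] : ~: block_set B != set0.
  by rewrite -card_gt0 cardsCs setCK card_block_set card_point subn_gt0.
rewrite inE => /replication_gt; have := card_blockE; have := replicationE.
have := dominating_points_le; have := dominating_blocks_le.
move: #|P| #|T| #|block D| replication => s t b r bts vst rE bE lt_kr.
(* From r >= k + 1: v - 1 = r (k - 1) >= k^2 - 1. *)
have k2v : k * k <= v by nia.
have krb : k * r <= b.
  rewrite -(@leq_pmul2r k) ?bE; last by lia.
  by rewrite mulnAC leq_mul2r k2v orbT.
rewrite leqNgt; apply/negP => st.
(* If t <= k - 1, then s + t k <= 2k - 2 + t (k - 1) <= k^2 - 1 < v. *)
have kt : k <= t by rewrite leqNgt; apply/negP => tk; nia.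
have sk : s + 2 <= k by lia.
(* Here b <= t + s r <= 2k - 2 + s (r - 1) <= k r + k - 2 r < k r, against [krb]. *)
by nia.
Qed.

End DominatingSet.

End LinearDesign.

Local Open Scope ring_scope.

(* The one-block design v = k has b = 1 <> v and gamma = 1, so the lower bound
   needs k < v; the upper bound holds there as well. *)
Theorem theorem1p5 (v k : nat) (D : design v k 1) :
  ~ symmetric_design D ->
  ((k < v)%N -> 2%:R * k%:R - 1 <= (gamma D)%:R :> rat) /\
  (gamma D)%:R <=
    (v%:R - k%:R ^+ 2) * (v%:R - 1) / (k%:R * (k%:R - 1))
      + 2%:R * k%:R - 1 :> rat.
Proof.
move=> nsymD; have k2 := design_k_ge2 D; have kv := design_k_le_v D.
split=> [lt_kv|].
  have [[S domS cardS] _] := domination_numberP (incidence_graph D).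
  have := dominating_ge nsymD domS lt_kv.
  rewrite cardS -/(gamma D) -(ler_nat rat) natrB ?natrM //; lia.
have /card_gt0P[B _] := card_block_gt0 D.
have := gamma_le nsymD B; have := card_disjoint_blocks B.
have := card_blockE D; have := replicationE D.
move: (gamma D) #|disjoint_blocks B| #|block D| (replication v k).
move=> g d b r rE bE dE; rewrite -(ler_nat rat) natrD => gd.
have {}rE : r%:R * (k%:R - 1) = v%:R - 1 :> rat.
  by move/(congr1 (fun n => n%:R : rat)): rE; rewrite natrM !natrB //; lia.
have {}bE : b%:R * k%:R = v%:R * r%:R :> rat by rewrite -!natrM bE.
have {}dE : d%:R + k%:R * r%:R + 1 = b%:R + k%:R :> rat.
  by rewrite -natrM -[1]/(1%:R) -!natrD dE.
have k0 : k%:R != 0 :> rat by rewrite pnatr_eq0; lia.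
have k1 : k%:R - 1 != 0 :> rat by rewrite subr_eq0 pnatr_eq1; lia.
(* Since (v - 1) / (k - 1) = r and v r / k = b, the fraction is b - k r, and [gd] with [dE] bounds
   [g] by b - k r + 2k - 1. *)
suff -> : (v%:R - k%:R ^+ 2) * (v%:R - 1) / (k%:R * (k%:R - 1))
            = b%:R - k%:R * r%:R :> rat by lra.
have -> : b%:R = v%:R * r%:R / k%:R :> rat by rewrite -bE mulfK.
by rewrite -rE; field; rewrite k0 k1.
Qed.
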